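(* Let $A$ be a noetherian commutative ring and $\mathfrak{a}$ an ideal of $A$. Suppose $M$ is an $\mathfrak{a}$-adically complete $A$-module. Then there is a surjection of $A$-modules $\phi : P \to M$ for some $\mathfrak{a}$-adically free $A$-module $P$.
   Context: An $A$-module $N$ is $\mathfrak{a}$-adically complete if the canonical homomorphism $N \to \varprojlim_i (N/\mathfrak{a}^{i+1}N)$ is bijective. Let $\widehat{A} := \varprojlim_i A/\mathfrak{a}^{i+1}$ be the $\mathfrak{a}$-adic completion of $A$. For $a \in \widehat{A}$ put $\operatorname{ord}_{\mathfrak{a}}(a) := \sup\{ i \in \mathbb{N} \mid a \in \mathfrak{a}^i\widehat{A} \}\in \mathbb{N}\cup\{\infty\}$. For a set $Z$, a function $f : Z \to \widehat{A}$ is decaying if for every $i \in \mathbb{N}$ the set $\{ z \in Z \mid \operatorname{ord}_{\mathfrak{a}}(f(z)) \leq i\}$ is finite; $\operatorname{F}_{\mathrm{dec}}(Z, \widehat{A})$ is the module (pointwise operations) of decaying functions. An $A$-module $P$ is $\mathfrak{a}$-adically free if it is isomorphic to the $A$-module $\operatorname{F}_{\mathrm{dec}}(Z, \widehat{A})$ for some set $Z$. *)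

(* Defs.v *)
From HB Require Import structures.
From mathcomp Require Import all_boot all_order all_algebra.
From mathcomp Require Import all_classical constructive_ereal.

Set Implicit Arguments.
Unset Strict Implicit.
Unset Printing Implicit Defensive.

Import Order.TTheory GRing.Theory Num.Theory.

Local Open Scope classical_set_scope.
Local Open Scope ring_scope.
Local Open Scope quotient_scope.

Section Submodules.
Variable A : comPzRingType.

Definition is_submodule (N : lmodType A) (L : set N) : Prop :=
  submod_closed [in L].

Definition is_ideal (I : set A) : Prop := is_submodule (I : set A^o).

Definition noetherian : Prop := forall I : set A, is_ideal I ->
  exists2 F : set A, finite_set F & I = smallest is_ideal F.

(* The product I L: the submodule of N generated by all x *: v with x in I
   and v in L. *)
Definition smul (N : lmodType A) (I : set A) (L : set N) : set N :=
  smallest (@is_submodule N) [set x *: v | x in I & v in L].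

(* A product of ideals is the case N = A^o of smul; the 0-th power is A. *)
Fixpoint ideal_pow (I : set A) (i : nat) : set A :=
  if i is j.+1 then smul (N := A^o) I (ideal_pow I j) else [set: A].

Lemma is_submoduleP (N : lmodType A) (L : set N) :
  is_submodule L <->
  L 0 /\ (forall (c : A) (u v : N), L u -> L v -> L (c *: u + v)).
Proof.
split=> [[L0 LD]|[L0 LD]]; split.
- by move: L0; rewrite !inE.
- by move=> c u v Lu Lv; have := LD c u v; rewrite !inE; apply.
- by rewrite !inE.
- by move=> c u v; rewrite !inE; apply: LD.
Qed.

Lemma smul_submodule (N : lmodType A) (I : set A) (L : set N) :
  is_submodule (smul I L).
Proof.
apply/is_submoduleP; split=> [B [/is_submoduleP[B0 _] _]//|c u v Lu Lv B sB].
have [/is_submoduleP[_ BD] _] := sB.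
by apply: BD; [exact: Lu | exact: Lv].
Qed.

Lemma smulS (N : lmodType A) (I J : set A) (L : set N) :
  I `<=` J -> smul I L `<=` smul J L.
Proof.
move=> IJ; apply: sub_smallest2r; first exact: smul_submodule.
by move=> _ [x Ix [v Lv <-]]; exists x; [exact: IJ | exists v].
Qed.

Lemma ideal_pow_ideal (I : set A) i : is_ideal (ideal_pow I i).
Proof. by case: i => [|i]; [apply/is_submoduleP|exact: smul_submodule]. Qed.

Lemma ideal_powS (I : set A) i j : (i <= j)%N ->
  ideal_pow I j `<=` ideal_pow I i.
Proof.
elim: j => [|j IHj]; first by rewrite leqn0 => /eqP->.
rewrite leq_eqVlt => /orP[/eqP->//|]; rewrite ltnS => /IHj; apply: subset_trans.
apply: smallest_sub; first exact: ideal_pow_ideal.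
have /is_submoduleP[I0 ID] := ideal_pow_ideal I j.
by move=> _ [x _ [y Iy <-]]; rewrite -[_ *: _]addr0; apply: ID.
Qed.

End Submodules.

Section AdicQuotient.
Variables (A : comPzRingType) (a : set A) (N : lmodType A).

Definition adic_submod (i : nat) : set N := smul (ideal_pow a i) [set: N].

Lemma adic_submod_submodule i : is_submodule (adic_submod i).
Proof. exact: smul_submodule. Qed.

Lemma adic_submodS i j : (i <= j)%N -> adic_submod j `<=` adic_submod i.
Proof. by move=> ij; apply: smulS; exact: ideal_powS. Qed.

Definition adic_pred (i : nat) : {pred N} := [in adic_submod i].

HB.instance Definition _ i := GRing.isSubmodClosed.Build A N (adic_pred i)
  (GRing.submod_closed_semi (adic_submod_submodule i)).

(* The quotient module N / a^(i+1) N, with the shifted index. *)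
Definition adic_quot (i : nat) : Type := Quotient.quot (adic_pred i.+1).

Section Lmodule.
Variable i : nat.
Local Notation Q := (adic_quot i).

HB.instance Definition _ := ZmodQuotient.on Q.

Lemma adic_quot_eqP (x y : N) :
  reflect (\pi_Q x = \pi_Q y) (x - y \in adic_pred i.+1).
Proof. by rewrite Quotient.idealrBE; exact: eqP. Qed.

Definition adic_quot_scale (c : A) (x : Q) : Q := \pi_Q (c *: repr x).

Lemma adic_quot_scaleE c (x : N) :
  adic_quot_scale c (\pi_Q x) = \pi_Q (c *: x).
Proof.
apply/adic_quot_eqP; rewrite -scalerBr rpredZ//.
by apply/adic_quot_eqP; rewrite reprK.
Qed.

Lemma adic_quot_scaleA b c (x : Q) :
  adic_quot_scale b (adic_quot_scale c x) = adic_quot_scale (b * c) x.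
Proof. by elim/quotW: x => x; rewrite (adic_quot_scaleE c) !adic_quot_scaleE scalerA. Qed.

Lemma adic_quot_scale1 : left_id 1 adic_quot_scale.
Proof. by elim/quotW => x; rewrite adic_quot_scaleE scale1r. Qed.

Lemma adic_quot_scaleDr : right_distributive adic_quot_scale +%R.
Proof.
move=> c; elim/quotW => x; elim/quotW => y.
by rewrite -raddfD !adic_quot_scaleE scalerDr raddfD.
Qed.

Lemma adic_quot_scaleDl (x : Q) :
  {morph adic_quot_scale^~ x : b c / b + c}.
Proof.
by move=> b c; elim/quotW: x => x; rewrite !adic_quot_scaleE scalerDl raddfD.
Qed.

HB.instance Definition _ := GRing.Zmodule_isLmodule.Build A Q
  adic_quot_scaleA adic_quot_scale1 adic_quot_scaleDr adic_quot_scaleDl.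

Definition adic_pi : N -> Q := \pi_Q.

Lemma adic_pi_is_linear : linear adic_pi.
Proof.
move=> c x y; rewrite -[c *: adic_pi x]/(adic_quot_scale c (\pi_Q x)).
by rewrite adic_quot_scaleE /adic_pi raddfD.
Qed.

HB.instance Definition _ := GRing.isLinear.Build A N Q _ adic_pi
  adic_pi_is_linear.

End Lmodule.

(* The transition map N / a^(j+1) N -> N / a^(i+1) N induced by the identity
   of N; it is meaningful only for i <= j, see adic_transE. *)
Definition adic_trans (i j : nat) (x : adic_quot j) : adic_quot i :=
  adic_pi i (repr x).

Lemma adic_transE i j (x : N) : (i <= j)%N ->
  adic_trans i (adic_pi j x) = adic_pi i x.
Proof.
move=> ij; apply/adic_quot_eqP; rewrite inE.
apply: (@adic_submodS i.+1 j.+1) => //.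
by have /adic_quot_eqP := reprK (adic_pi j x); rewrite inE.
Qed.

Lemma adic_trans_is_linear i j : (i <= j)%N -> linear (@adic_trans i j).
Proof.
move=> ij c; elim/quotW => x; elim/quotW => y.
by rewrite -!/(adic_pi j _) -linearP !adic_transE// linearP.
Qed.

End AdicQuotient.

Section AdicCompletion.
Variables (A : comPzRingType) (a : set A) (N : lmodType A).
Local Notation Q := (adic_quot a N).

(* The inverse limit of the modules N / a^(i+1) N. *)
Record adic_completion : Type := AdicCompletion {
  adic_coord :> forall i, Q i;
  adic_coordP : `[< forall i j, (i <= j)%N ->
                    adic_trans i (adic_coord j) = adic_coord i >] }.

HB.instance Definition _ := [isSub for adic_coord].
HB.instance Definition _ := [Choice of adic_completion by <:].

Local Notation C := adic_completion.

Lemma adic_transC (x : C) i j : (i <= j)%N -> adic_trans i (x j) = x i.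
Proof. by move=> ij; have /asboolP := adic_coordP x; apply. Qed.

Lemma adic_completionP (x y : C) : (forall i, x i = y i) -> x = y.
Proof. by move=> xy; apply: val_inj; apply: functional_extensionality_dep. Qed.

Lemma adic_lin_subproof (c : A) (x y : C) :
  `[< forall i j, (i <= j)%N ->
      adic_trans i (c *: x j + y j) = c *: x i + y i >].
Proof.
by apply/asboolP => i j ij; rewrite adic_trans_is_linear// !adic_transC.
Qed.

Lemma adic_canon_subproof (n : N) :
  `[< forall i j, (i <= j)%N ->
      adic_trans i (adic_pi a j n) = adic_pi a i n >].
Proof. by apply/asboolP => i j ij; rewrite adic_transE. Qed.

Definition adic_canon (n : N) : C := AdicCompletion (adic_canon_subproof n).

Definition adic_lin c x y : C := AdicCompletion (adic_lin_subproof c x y).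
Let zeroC : C := adic_canon 0.
Let addC : C -> C -> C := adic_lin 1.
Let oppC (x : C) : C := adic_lin (-1) x zeroC.
Let scaleC c (x : C) : C := adic_lin c x zeroC.

Let zeroE i : zeroC i = 0. Proof. exact: linear0. Qed.
Let addE x y i : addC x y i = x i + y i. Proof. by rewrite /= scale1r. Qed.
Let oppE x i : oppC x i = - x i.
Proof. by rewrite [LHS]/= linear0 addr0 scaleN1r. Qed.
Let scaleE c x i : scaleC c x i = c *: x i.
Proof. by rewrite [LHS]/= linear0 addr0. Qed.

Let addCA : associative addC.
Proof. by move=> x y z; apply: adic_completionP => i; rewrite !addE addrA. Qed.
Let addCC : commutative addC.
Proof. by move=> x y; apply: adic_completionP => i; rewrite !addE addrC. Qed.
Let add0C : left_id zeroC addC.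
Proof. by move=> x; apply: adic_completionP => i; rewrite addE zeroE add0r. Qed.
Let addNC : left_inverse zeroC oppC addC.
Proof.
by move=> x; apply: adic_completionP => i; rewrite addE oppE zeroE addNr.
Qed.

HB.instance Definition _ := GRing.isZmodule.Build C addCA addCC add0C addNC.

Let scaleCA b c x : scaleC b (scaleC c x) = scaleC (b * c) x.
Proof. by apply: adic_completionP => i; rewrite !scaleE scalerA. Qed.
Let scale1C : left_id 1 scaleC.
Proof. by move=> x; apply: adic_completionP => i; rewrite scaleE scale1r. Qed.
Let scaleCDr : right_distributive scaleC +%R.
Proof.
move=> c x y; apply: adic_completionP => i.
by rewrite scaleE !addE !scaleE scalerDr.
Qed.
Let scaleCDl x : {morph scaleC^~ x : b c / b + c}.
Proof.
by move=> b c; apply: adic_completionP => i; rewrite addE !scaleE scalerDl.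
Qed.

HB.instance Definition _ := GRing.Zmodule_isLmodule.Build A C
  scaleCA scale1C scaleCDr scaleCDl.

Lemma adic_coordD (x y : C) i : (x + y) i = x i + y i.
Proof. exact: addE. Qed.

Lemma adic_coordZ c (x : C) i : (c *: x) i = c *: x i.
Proof. exact: scaleE. Qed.

Lemma adic_canon_is_linear : linear adic_canon.
Proof.
move=> c x y; apply: adic_completionP => i.
by rewrite adic_coordD adic_coordZ /= linearP.
Qed.

HB.instance Definition _ := GRing.isLinear.Build A N C _ adic_canon
  adic_canon_is_linear.

Definition adically_complete : Prop := bijective adic_canon.

End AdicCompletion.

Section DecayingFunctions.
Variables (A : comPzRingType) (a : set A).

(* Only the A-module structure of the completion is needed: the ideal of the
   completed ring generated by the image of a^i is the A-submodule a^i Ahat. *)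
Definition Ahat : lmodType A := adic_completion a A^o.

(* The supremum is taken in \bar int; it lies in {0, 1, ...} U {+oo}. *)
Definition ord (x : Ahat) : \bar int :=
  supremum 0%E [set i%:Z%:E | i in [set i : nat | adic_submod a i x]].

Lemma ord_supremums (x : Ahat) :
  supremums [set i%:Z%:E | i in [set i : nat | adic_submod a i x]] (ord x).
Proof.
set S := [set i : nat | _]; set E := [set _ | _ in S].
have S0 : S 0%N.
  move=> B [_]; apply; exists 1 => //; exists x => //.
  by rewrite scale1r.
have E0 : E != set0 by apply/set0P; exists 0%E; exists 0%N.
suff [m Em] : supremums E !=set0.
  by rewrite /ord /supremum -/S -/E (negbTE E0); exact: (xgetI _ Em).
have [[m Sm]|nS] := pselect (exists m, forall i, S i -> (i <= m)%N).
  have ex : exists i, `[< S i >] by exists 0%N; apply/asboolP.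
  have ub i : `[< S i >] -> (i <= m)%N by move=> /asboolP/Sm.
  case: (ex_maxnP ex ub) => k /asboolP Sk kP.
  exists k%:Z%:E; split.
    by move=> _ [i Si <-]; rewrite lee_fin lez_nat kP//; apply/asboolP.
  by move=> y; apply; exists k.
exists +oo%E; split=> [y _|y yE]; first exact: leey.
have big m : exists2 i, S i & (m < i)%N.
  apply: contra_notP nS => nm; exists m => i Si; rewrite leqNgt.
  by apply/negP => mi; apply: nm; exists i.
case: y yE => [r| //|] yE.
- have [i Si ri] := big `|r|%N.
  have : (i%:Z%:E <= r%:E)%E by apply: yE; exists i.
  rewrite lee_fin => ir; exfalso.
  have : (i%:Z <= `|r|%N%:Z) by rewrite abszE (le_trans ir)// ler_norm.
  by rewrite lez_nat leqNgt ri.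
- have : (0%:E <= -oo :> \bar int)%E by apply: yE; exists 0%N.
  by rewrite leeNy_eq.
Qed.

Lemma ord_leP (x : Ahat) (i : nat) :
  (ord x <= i%:Z%:E)%E <-> ~ adic_submod a i.+1 x.
Proof.
have [ub lub] := ord_supremums x; split=> [xi xS|nx].
  have : (i.+1%:Z%:E <= i%:Z%:E :> \bar int)%E.
    by apply: le_trans xi; apply: ub; exists i.+1.
  by rewrite lee_fin lez_nat ltnn.
apply: lub => _ [j xj <-]; rewrite lee_fin lez_nat leqNgt.
by apply/negP => ij; apply: nx; apply: adic_submodS xj.
Qed.

Section Fdec.
Variable Z : Type.

Definition decaying (f : Z -> Ahat) : Prop :=
  forall i : nat, finite_set [set z | (ord (f z) <= i%:Z%:E)%E].

Lemma decaying_submodule : is_submodule (decaying : set (Z -> Ahat)).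
Proof.
apply/is_submoduleP; split=> [i|c f g df dg i].
  rewrite (_ : [set _ | _] = set0)//; apply/seteqP; split=> z //= /ord_leP[].
  by have /is_submoduleP[] := @adic_submod_submodule A a Ahat i.+1.
have dfg : finite_set ([set z | (ord (f z) <= i%:Z%:E)%E] `|`
                       [set z | (ord (g z) <= i%:Z%:E)%E]).
  by rewrite finite_setU; split.
apply: sub_finite_set dfg => z /= /ord_leP nfg; apply: contra_notP nfg => nz.
have /is_submoduleP[_] := @adic_submod_submodule A a Ahat i.+1; apply.
- by apply: contra_notP nz => h; left; apply/ord_leP.
- by apply: contra_notP nz => h; right; apply/ord_leP.
Qed.

Definition decaying_pred : {pred Z -> Ahat} := [in (decaying : set _)].

HB.instance Definition _ := GRing.isSubmodClosed.Build A (Z -> Ahat)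
  decaying_pred (GRing.submod_closed_semi decaying_submodule).

Record Fdec : Type :=
  MkFdec { Fdec_fun :> Z -> Ahat; FdecP : Fdec_fun \in decaying_pred }.

HB.instance Definition _ := [isSub for Fdec_fun].
HB.instance Definition _ := [Choice of Fdec by <:].
HB.instance Definition _ := [SubChoice_isSubLmodule of Fdec by <:].

End Fdec.

Definition adically_free (P : lmodType A) : Prop :=
  exists (Z : Type) (f : {linear Fdec Z -> P}), bijective f.

End DecayingFunctions.

(* Main.v *)
From HB Require Import structures.
Require Import Defs.
From mathcomp Require Import all_boot all_order all_algebra.
From mathcomp Require Import all_classical constructive_ereal.

Import Order.TTheory GRing.Theory Num.Theory.

Local Open Scope ring_scope.

(** Index the decaying functions by the underlying set of [M] itself.  A
    decaying function [f] defines a formal series, the sum over all [z] in [M]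
    of [f z *: z].  Modulo [a^(i+1) M] this series is a finite sum: a coefficient
    lying in [a^(i+1) Ahat] has zero [i]-th coordinate in [A / a^(i+1)], and
    decay says that all but finitely many coefficients lie there.  The
    finite sums are linear in [f] and compatible as [i] varies, so they define
    a linear map from the decaying functions to the completion of [M]
    ([series], [series_linear]).

    Since [M] is complete, its completion can be identified with [M], and the
    series becomes a linear map into [M].  It is onto because every element [m]
    is one of the indices: the function with value [1] at [m] and [0] elsewhere
    is decaying, and its series is [m] ([series_delta]). *)

(** * Coordinates of deep elements of a completion *)

Lemma adic_submod_linear (A : comPzRingType) (a : set A) (N N' : lmodType A)
    (g : N -> N') (i : nat) (x : N) :
  linear g -> adic_submod a i x -> adic_submod a i (g x).
Proof.
move=> g_lin; have g0 : g 0 = 0.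
  by have := g_lin (-1) 0 0; rewrite !scaleN1r !addNr.
have [S0 SD] := (is_submoduleP _).1 (@adic_submod_submodule A a N' i).
move: x; apply: (smallest_sub (X := fun y => adic_submod a i (g y))).
  apply/is_submoduleP; split=> [|c u v Su Sv]; first by rewrite g0.
  by rewrite g_lin; apply: SD.
move=> _ [c ac [v _ <-]]; rewrite -[c *: v]addr0 g_lin g0.
rewrite addr0 => B [_]; apply.
by exists c => //; exists (g v).
Qed.

Lemma adic_quot_eq0 (A : comPzRingType) (a : set A) (N : lmodType A) (i : nat)
    (q : adic_quot a N i) :
  adic_submod a i.+1 q -> q = 0.
Proof.
move=> aq; suff : ([set 0] : set (adic_quot a N i))%classic q by [].
apply: (smallest_sub (X := [set 0]%classic) _ _ aq) => [|_ [c ac [v _ <-]]].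
  by apply/is_submoduleP; split=> // c u v -> ->; rewrite scaler0 addr0.
elim/quotW: v => n; rewrite /= -/(adic_pi a i n) -linearZ.
rewrite -(linear0 (adic_pi a i)).
apply/adic_quot_eqP; rewrite subr0 inE => B [_]; apply.
by exists c => //; exists n.
Qed.

(** This is what turns decay into finiteness: the condition on [x] refers to
    the module structure of the completion, and is transported along the
    linear [i]-th coordinate to [N / a^(i+1) N], where [a^(i+1)] acts by zero. *)
Lemma adic_coord_eq0 (A : comPzRingType) (a : set A) (N : lmodType A) (i : nat)
    (x : adic_completion a N) :
  adic_submod a i.+1 x -> x i = 0.
Proof.
move=> ax; apply: adic_quot_eq0.
apply: (@adic_submod_linear _ _ _ _ (fun x : adic_completion a N => x i)) ax.
by move=> c u v; rewrite adic_coordD adic_coordZ.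
Qed.

(** * Multiplying an element of M by a residue class of scalars *)

(** The pairing of [A / a^(i+1)] and [M] with values in [M / a^(i+1) M].  It is
    defined through representatives; [quot_act_pi] is the independence of the
    choice. *)
Definition quot_act {A : comPzRingType} {a : set A} {M : lmodType A} {i : nat}
    (q : adic_quot a A^o i) (m : M) : adic_quot a M i :=
  adic_pi a i ((repr q : A) *: m).

Lemma quot_act_pi (A : comPzRingType) (a : set A) (M : lmodType A) (i : nat)
    (c : A^o) (m : M) : quot_act (adic_pi a i c) m = adic_pi a i (c *: m).
Proof.
apply/adic_quot_eqP; rewrite -scalerBl inE.
apply: (@adic_submod_linear _ _ A^o M (fun x : A => x *: m)) => [b x y|].
  by rewrite scalerDl scalerA.
by have /adic_quot_eqP := reprK (adic_pi a i c); rewrite inE.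
Qed.

Lemma quot_act_linear (A : comPzRingType) (a : set A) (M : lmodType A)
    (i : nat) (m : M) : linear (fun q : adic_quot a A^o i => quot_act q m).
Proof.
move=> c; elim/quotW => x; elim/quotW => y; rewrite -!/(adic_pi a i _) -linearP.
by rewrite !quot_act_pi scalerDl -scalerA linearP.
Qed.

Lemma quot_act_trans (A : comPzRingType) (a : set A) (M : lmodType A)
    (i j : nat) (q : adic_quot a A^o j) (m : M) : (i <= j)%N ->
  adic_trans i (quot_act q m) = quot_act (adic_trans i q) m.
Proof. by move=> ij; rewrite adic_transE// /adic_trans quot_act_pi. Qed.

(** * The series of a decaying function *)

(** A sum with finite support is indexed by its own support; this rewrites
    it over any finite set containing the support, so that sums attached to
    different functions or different levels can be compared termwise. *)
Lemma fsumT_seq (V : nmodType) (T : choiceType) (D : set T) (F : T -> V) :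
  finite_set D -> (forall t, F t != 0 -> D t) ->
  \sum_(t \in [set: T]%classic) F t =
  \sum_(t <- finmap.enum_fset (fset_set D)) F t.
Proof.
move=> finD FD; rewrite -fsbig_finite//; apply/esym/fsbig_widen => // t [_ nDt].
by apply/eqP/negPn/negP => /FD.
Qed.

Section Series.
Context {A : comPzRingType} {a : set A} {M : lmodType A}.
Implicit Types f g : Fdec a M.

(** The indices whose coefficients can contribute modulo [a^(i+1) M]. *)
Definition large f (i : nat) : set M :=
  [set z | (ord (f z) <= i%:Z%:E)%E]%classic.

Lemma finite_large f i : finite_set (large f i).
Proof. by have := FdecP f; rewrite inE; apply. Qed.

Lemma large_coord f i z : f z i != 0 -> large f i z.
Proof. by move=> fz; apply/ord_leP => /adic_coord_eq0/eqP; apply/negP. Qed.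

Lemma quot_act0 i (m : M) : quot_act (0 : adic_quot a A^o i) m = 0.
Proof. by rewrite -(linear0 (adic_pi a i)) quot_act_pi scale0r linear0. Qed.

Definition series_coord f (i : nat) : adic_quot a M i :=
  \sum_(z \in [set: M]%classic) quot_act (f z i) z.

Lemma series_coord_seq f i (D : set M) :
  finite_set D -> (large f i `<=` D)%classic ->
  series_coord f i =
  \sum_(z <- finmap.enum_fset (fset_set D)) quot_act (f z i) z.
Proof.
move=> finD fD; apply: fsumT_seq => // z.
apply: contraNP => nDz.
by have [->|/large_coord/fD//] := eqVneq (f z i) 0; rewrite quot_act0.
Qed.

(** The transition maps send each term at level [j] to the term with the same
    index at level [i]; the larger set [large f j] serves for both sums. *)
Lemma series_subproof f :
  `[< forall i j, (i <= j)%N ->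
      adic_trans i (series_coord f j) = series_coord f i >].
Proof.
apply/asboolP => i j ij.
have large_ij : (large f i `<=` large f j)%classic.
  by move=> z; rewrite /large/= => /le_trans; apply; rewrite lee_fin lez_nat.
rewrite !(series_coord_seq _ _ _ (finite_large f j))//.
(* The transition map is evaluated on classes of elements of [M], so the sum at
   level [j] is first written as a single class. *)
rewrite /quot_act -linear_sum adic_transE// linear_sum; apply: eq_bigr => z _.
by rewrite -[RHS]/(quot_act _ z) -(adic_transC (f z) ij) -quot_act_trans ?adic_transE.
Qed.

Definition series f : adic_completion a M := AdicCompletion (series_subproof f).

Lemma series_linear : linear series.
Proof.
move=> c f g; apply: adic_completionP => i; rewrite adic_coordD adic_coordZ /=.
pose D := (large f i `|` large g i)%classic.
have fgE z : (c *: f + g) z i = c *: f z i + g z i.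
  by rewrite -adic_coordZ -adic_coordD.
have finD : finite_set D by rewrite finite_setU; split; exact: finite_large.
rewrite (series_coord_seq f _ D finD (@subsetUl _ _ _)).
rewrite (series_coord_seq g _ D finD (@subsetUr _ _ _)).
rewrite scaler_sumr -big_split /=.
rewrite [LHS](fsumT_seq _ _ D)//.
  by apply: eq_bigr => z _; rewrite fgE quot_act_linear.
move=> z; rewrite fgE; apply: contraNP => /not_orP[nf ng].
have [->|/large_coord//] := eqVneq (f z i) 0.
have [->|/large_coord//] := eqVneq (g z i) 0.
by rewrite scaler0 addr0 quot_act0.
Qed.

Lemma decaying_delta (m : M) :
  (fun z : M => if z == m then adic_canon a (1 : A^o) else 0 : Ahat a)
    \in @decaying_pred A a M.
Proof.
rewrite inE => i; apply: (@sub_finite_set _ _ [set m]%classic) => // z /=.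
move=> /ord_leP; apply: contra_notP => /eqP/negPf->.
by have /is_submoduleP[] := @adic_submod_submodule A a (Ahat a) i.+1.
Qed.

Definition delta (m : M) : Fdec a M := MkFdec (decaying_delta m).

Lemma series_delta (m : M) : series (delta m) = adic_canon a m.
Proof.
apply: adic_completionP => i; rewrite /= /series_coord.
rewrite -(@fsbig_widen _ _ _ _ [set m]%classic) => [|//|z [_ /eqP/negPf zm] /=].
  by rewrite fsbig_set1 /= eqxx quot_act_pi scale1r.
have coord0 : (0 : Ahat a) i = 0 := linear0 (adic_pi a i).
by rewrite zm coord0 quot_act0.
Qed.

End Series.

Theorem corollary3p15 (A : comPzRingType) (A_noetherian : noetherian A)
    (a : set A) (a_ideal : is_ideal a)
    (M : lmodType A) (M_complete : adically_complete a M) :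
  exists P : lmodType A, adically_free a P /\
    exists phi : {linear P -> M}, set_surj [set: P]%classic [set: M]%classic phi.
Proof.
have [lim canonK limK] := M_complete.
(* [lim] sums the series: it is the inverse of the canonical map. *)
have lim_linear := can2_linear canonK limK.
pose phi (f : Fdec a M) : M := lim (series f).
have phi_linear : linear phi.
  by move=> c f g; rewrite /phi series_linear lim_linear.
pose phiL : {linear Fdec a M -> M} :=
  HB.pack phi (GRing.isLinear.Build A (Fdec a M) M _ phi phi_linear).
exists (Fdec a M); split; first by exists M, idfun; exists idfun.
exists phiL => m _; exists (delta m) => //.
by rewrite /= /phi series_delta canonK.
Qed.
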